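(* Let $(G,\mathcal{X}_V,\mathfrak{p},r)$ be a parametrized influence diagram with $G=(V^{\mathrm{s}},V^{\mathrm{a}},E)$ and utility vertices $V^{\mathrm{r}}\subseteq V^{\mathrm{s}}$, and let $\mathcal{G}$ be a rooted junction tree on $G$ in which the offspring of $C_v$ is $\{v\}$ for every $v\in V$. Consider the three problems $$\text{(MEU)}\quad \max_{\delta\in\Delta}\ \mathbb{E}_\delta\Big[\sum_{v\in V^{\mathrm{r}}}r_v(X_v)\Big],$$ $$\text{(NLP)}\quad \max_{\mu,\delta}\ \sum_{v\in V^{\mathrm{r}}}\langle r_v,\mu_v\rangle\quad\text{s.t.}\quad \mu\in\overline{\mathcal{P}},\ \ \delta\in\Delta,\ \ \mu_{C_v}=\delta_{v|\mathrm{pa}(v)}\,\mu_{\check C_v}\ \text{ for all } v\in V^{\mathrm{a}},$$ $$\text{(NLP')}\quad \max_{\mu\in\mathcal{S}(G)}\ \sum_{v\in V^{\mathrm{r}}}\langle r_v,\mu_v\rangle .$$ Then (NLP) and (NLP') are equivalent to (MEU), in the sense that all three have the same value and that, if $(\mu,\delta)$ is a feasible solution of (NLP), then $\delta$ is an admissible policy for (MEU) and $\mu$ is the vector of moments of the distribution induced by $\delta$, i.e. $\mu_{C_v}(x_{C_v})=\mathbb{P}_\delta(X_{C_v}=x_{C_v})$ for all $v\in V$ and $x_{C_v}\in\mathcal{X}_{C_v}$.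
   Context: Influence diagrams. An influence diagram (ID) $G=(V^{\mathrm{s}},V^{\mathrm{a}},E)$ is a finite acyclic digraph with vertex set $V=V^{\mathrm{s}}\sqcup V^{\mathrm{a}}$, where $V^{\mathrm{a}}$ is the set of decision vertices and $V^{\mathrm{s}}$ is the disjoint union of the chance vertices and the utility vertices $V^{\mathrm{r}}$; utility vertices have no children. $\mathrm{pa}(v)$ denotes the parents of $v$, $\mathrm{fa}(v)=\{v\}\cup\mathrm{pa}(v)$. A parametrization $(\mathcal{X}_V,\mathfrak{p},r)$ consists of finite nonempty sets $\mathcal{X}_v$ ($v\in V$), conditional distributions $\mathfrak{p}=\{p_{v|\mathrm{pa}(v)}\}_{v\in V^{\mathrm{s}}}$ on $\mathcal{X}_v$ given $\mathcal{X}_{\mathrm{pa}(v)}$, and rewards $r_v:\mathcal{X}_v\to\mathbb{R}$, $v\in V^{\mathrm{r}}$; here $\mathcal{X}_C=\prod_{v\in C}\mathcal{X}_v$. A policy is $\delta=(\delta_{v|\mathrm{pa}(v)})_{v\in V^{\mathrm{a}}}\in\Delta=\prod_{v\in V^{\mathrm{a}}}\Delta_v$, where $\Delta_v$ is the set of conditional distributions on $\mathcal{X}_v$ given $\mathcal{X}_{\mathrm{pa}(v)}$. It induces the distribution $\mathbb{P}_\delta(X_V=x_V)=\prod_{v\in V^{\mathrm{s}}}p_{v|\mathrm{pa}(v)}(x_v|x_{\mathrm{pa}(v)})\prod_{v\in V^{\mathrm{a}}}\delta_{v|\mathrm{pa}(v)}(x_v|x_{\mathrm{pa}(v)})$, with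 expectation $\mathbb{E}_\delta$. Rooted junction trees. A junction tree of $G$ is an undirected tree whose nodes are subsets of $V$, such that each $\mathrm{fa}(v)$ is contained in some node, and for any two nodes $C_1,C_2$ every node on the path between them contains $C_1\cap C_2$. A rooted junction tree (RJT) $\mathcal{G}$ on $G$ is a rooted tree (arcs directed away from the root) with nodes in $2^V$ whose underlying undirected graph is a junction tree of $G$ and such that $\mathrm{fa}(v)\subseteq C_v$ for all $v$, where $C_v$ (root clique of $v$) is the root of the subtree induced by the nodes containing $v$. The offspring of a node $C$ is $\{v:C_v=C\}$. RJTs in which the offspring of $C_v$ is $\{v\}$ for all $v$ are understood to have exactly the nodes $(C_v)_{v\in V}$. Put $\check C_v=C_v\setminus\{v\}$. Polytopes. $\mathcal{L}_{\mathcal{G}}$ is the set of $\mu=(\mu_{C_v},\mu_{\check C_v})_{v\in V}$ such that each $\mu_{C_v}$ is a probability distribution on $\mathcal{X}_{C_v}$, adjacent nodes $C,C'$ of $\mathcal{G}$ satisfy $\sum_{x_{C\setminus C'}}\mu_C=\sum_{x_{C'\setminus C}}\mu_{C'}$, and $\mu_{\check C_v}=\sum_{x_v}\mu_{C_v}$. Equalities between functions are pointwise, e.g. $\mu_{C_v}=\mu_{\check C_v}p_{v|\mathrm{pa}(v)}$ means $\mu_{C_v}(x_{C_v})=\mu_{\check C_v}(x_{\check C_v})p_{v|\mathrm{pa}(v)}(x_v|x_{\mathrm{pa}(v)})$ for all $x_{C_v}$. Define $\overline{\mathcal{P}}=\{\mu\in\mathcal{L}_{\mathcal{G}}:\mu_{C_v}=\mu_{\check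 C_v}\,p_{v|\mathrm{pa}(v)}\ \forall v\in V^{\mathrm{s}}\}$ and $\mathcal{S}(G)=\{\mu\in\overline{\mathcal{P}}:\exists\delta\in\Delta,\ \mu_{C_v}=\mu_{\check C_v}\,\delta_{v|\mathrm{pa}(v)}\ \forall v\in V^{\mathrm{a}}\}$. For $v\in V^{\mathrm{r}}$, $\mu_v$ is the marginal of $\mu_{C_v}$ on $\mathcal{X}_v$ and $\langle r_v,\mu_v\rangle=\sum_{x_v}r_v(x_v)\mu_v(x_v)$. *)

(* Defs.v *)
From mathcomp Require Import all_boot all_order all_algebra.
From mathcomp Require Import reals.

Set Implicit Arguments.
Unset Strict Implicit.
Unset Printing Implicit Defensive.

Import Order.TTheory GRing.Theory Num.Theory.
Local Open Scope ring_scope.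

(* Vertices are split into decision vertices [decv] and the rest [statev];
   the chance vertices are [statev :\: utilv]. *)
Record influence_diagram (V : finType) := InfluenceDiagram {
  edge : rel V;
  decv : {set V};
  utilv : {set V};
  edge_acyclic : forall u v, edge u v -> ~~ connect edge v u;
  utilv_decv : [disjoint utilv & decv];
  utilv_childless : forall u v, u \in utilv -> ~~ edge u v }.

Section Graphs.
Variables (V : finType) (G : influence_diagram V).

Definition statev : {set V} := ~: decv G.
Definition pa (v : V) : {set V} := [set u | edge G u v].
Definition fa (v : V) : {set V} := v |: pa v.

End Graphs.

Definition simple_path (T : eqType) (e : rel T) (x : T) (p : seq T) (y : T) :=
  [/\ path e x p, uniq (x :: p) & last x p = y].

Definition is_tree (T : finType) (N : {set T}) (e : rel T) :=
  [/\ N != set0,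
      forall x y, e x y -> [/\ x \in N, y \in N & x != y],
      symmetric e
    & {in N &, forall x y, exists! p, simple_path e x p y}].

Section JunctionTrees.
Variables (V : finType) (G : influence_diagram V).

Definition is_junction_tree (N : {set {set V}}) (e : rel {set V}) :=
  [/\ is_tree N e,
      forall v, exists2 C, C \in N & fa G v \subset C
    & {in N &, forall C1 C2 p, simple_path e C1 p C2 ->
        forall C, C \in C1 :: p -> C1 :&: C2 \subset C}].

Record rooted_graph := RootedGraph {
  nodes : {set {set V}};
  root : {set V};
  tarc : rel {set V} }.

Implicit Type T : rooted_graph.

Definition adj T : rel {set V} := [rel C D | tarc T C D || tarc T D C].

(* Given that the underlying graph is a tree, the last two conditions say that
   each of its edges carries a single orientation, away from the root. *)
Definition is_rooted_tree T :=
  [/\ is_tree (nodes T) (adj T),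
      root T \in nodes T,
      forall C D, tarc T C D -> ~~ tarc T D C
    & {in nodes T, forall C, connect (tarc T) (root T) C}].

Definition is_root_clique T (v : V) (C : {set V}) :=
  [&& C \in nodes T, v \in C &
    [forall D, (D \in nodes T) && (v \in D) ==>
      connect [rel A B | [&& tarc T A B, v \in A & v \in B]] C D]].

(* The default [set0] is never reached in a rooted junction tree: the inclusion
   [fa G v \subset root_clique T v] required below rules it out. *)
Definition root_clique T (v : V) : {set V} :=
  odflt set0 [pick C | is_root_clique T v C].

Definition offspring T (C : {set V}) : {set V} := [set v | root_clique T v == C].

Record rjt := RJT {
  rjt_graph :> rooted_graph;
  rjt_rooted : is_rooted_tree rjt_graph;
  rjt_junction : is_junction_tree (nodes rjt_graph) (adj rjt_graph);
  fa_root_clique : forall v, fa G v \subset root_clique rjt_graph v }.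

Definition singleton_offspring T :=
  (forall v, offspring T (root_clique T v) = [set v]) /\
  nodes T = [set root_clique T v | v : V].

Definition check_clique T (v : V) : {set V} := root_clique T v :\ v.

Lemma mem_root_clique (T : rjt) v : v \in root_clique T v.
Proof. by apply: (subsetP (fa_root_clique T v)); exact: setU11. Qed.

Lemma pa_root_clique (T : rjt) v : pa G v \subset root_clique T v.
Proof. by apply: subset_trans (fa_root_clique T v); exact: subsetUr. Qed.

Lemma check_clique_sub T v : check_clique T v \subset root_clique T v.
Proof. exact: subsetDl. Qed.

End JunctionTrees.

Section Assignments.
Variables (V : finType) (X : V -> finType).

Definition assign (C : {set V}) := {dffun forall i : {v : V | v \in C}, X (val i)}.

Definition coord (C : {set V}) (v : V) (vC : v \in C) (x : assign C) : X v :=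
  x (exist _ v vC).

Definition restr (C D : {set V}) (DC : D \subset C) (x : assign C) : assign D :=
  [ffun i : {v : V | v \in D} => coord (subsetP DC _ (valP i)) x].

End Assignments.

Definition is_dist (R : realType) (A : finType) (f : A -> R) :=
  (forall a, 0 <= f a) /\ \sum_a f a = 1.

(* Families of conditional laws of [X_v] given [X_(pa v)].  They are indexed by
   all vertices; only the entries in [statev G] (model) or [decv G] (policies)
   are constrained and used. *)
Definition kernels (R : realType) (V : finType) (G : influence_diagram V)
    (X : V -> finType) :=
  forall v, assign X (pa G v) -> X v -> R.

Definition is_cond_dist (R : realType) (V : finType) (G : influence_diagram V)
    (X : V -> finType) (W : {set V}) (k : kernels R G X) :=
  {in W, forall v (y : assign X (pa G v)), is_dist (k v y)}.

Record parametrization (R : realType) (V : finType) (G : influence_diagram V)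
    (X : V -> finType) := Parametrization {
  space_gt0 : forall v, (0 < #|X v|)%N;
  kern : kernels R G X;
  kern_dist : is_cond_dist (statev G) kern;
  reward : forall v, X v -> R }.

Section Policies.
Variables (R : realType) (V : finType) (G : influence_diagram V).
Variables (X : V -> finType) (P : parametrization R G X).

Definition policies (delta : kernels R G X) : Prop :=
  is_cond_dist (decv G) delta.

Definition factor (k : kernels R G X) (x : assign X [set: V]) (v : V) : R :=
  k v (restr (subsetT (pa G v)) x) (coord (in_setT v) x).

Definition joint (delta : kernels R G X) (x : assign X [set: V]) : R :=
  (\prod_(v in statev G) factor (kern P) x v) *
  (\prod_(v in decv G) factor delta x v).

Definition prob (delta : kernels R G X) (C : {set V}) (xC : assign X C) : R :=
  \sum_(x : assign X [set: V] | restr (subsetT C) x == xC) joint delta x.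

Definition expectation (delta : kernels R G X) (f : assign X [set: V] -> R) : R :=
  \sum_x joint delta x * f x.

Definition meu_objective (delta : kernels R G X) : R :=
  expectation delta (fun x => \sum_(v in utilv G) reward P (coord (in_setT v) x)).

End Policies.

Section Polytopes.
Variables (R : realType) (V : finType) (G : influence_diagram V).
Variables (X : V -> finType) (P : parametrization R G X) (T : rjt G).

Record moments := Moments {
  mu_clique : forall v, assign X (root_clique T v) -> R;
  mu_check : forall v, assign X (check_clique T v) -> R }.

Definition marg (C D : {set V}) (DC : D \subset C) (f : assign X C -> R)
    (y : assign X D) : R :=
  \sum_(x | restr DC x == y) f x.

Definition local_polytope (mu : moments) : Prop :=
  [/\ forall v, is_dist (@mu_clique mu v),
      forall u v, adj T (root_clique T u) (root_clique T v) ->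
        marg (subsetIl (root_clique T u) (root_clique T v)) (@mu_clique mu u) =1
        marg (subsetIr (root_clique T u) (root_clique T v)) (@mu_clique mu v)
    & forall v, @mu_check mu v =1
        marg (check_clique_sub T v) (@mu_clique mu v)].

Definition factorizes (k : kernels R G X) (mu : moments) (v : V) : Prop :=
  forall x : assign X (root_clique T v),
    mu_clique mu x = mu_check mu (restr (check_clique_sub T v) x) *
                     k v (restr (pa_root_clique T v) x)
                         (coord (mem_root_clique T v) x).

Definition Pbar (mu : moments) : Prop :=
  local_polytope mu /\ {in statev G, forall v, factorizes (kern P) mu v}.

Definition NLP_feasible (md : moments * kernels R G X) : Prop :=
  [/\ Pbar md.1, policies md.2 & {in decv G, forall v, factorizes md.2 md.1 v}].

Definition SG (mu : moments) : Prop :=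
  Pbar mu /\ exists delta : kernels R G X,
    policies delta /\ {in decv G, forall v, factorizes delta mu v}.

Definition mu_vertex (mu : moments) (v : V) (a : X v) : R :=
  \sum_(x | coord (mem_root_clique T v) x == a) mu_clique mu x.

Definition nlp_objective (mu : moments) : R :=
  \sum_(v in utilv G) \sum_(a : X v) reward P a * mu_vertex mu a.

End Polytopes.

Definition max_value (R : realType) (S : Type) (A : S -> Prop) (f : S -> R) (z : R) :=
  (exists2 s, A s & f s = z) /\ (forall s, A s -> f s <= z).

(* Main.v *)
(* In a rooted junction tree whose cliques have one offspring each, the clique of
   u lies above the clique of v whenever u is an ancestor of v in G, so C_v meets
   the descendants of v only in v. Summing these out shows that the law of C_v
   under a policy is the law of C_v \ v times the kernel of v; hence the moments
   of a policy are feasible. Conversely, C_v \ v is contained in the parent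
   clique, so local consistency and the kernels determine a feasible mu by
   induction from the root. The common maximum exists because the expected
   utility is affine in each conditional law delta_v(. | y), so every policy is
   dominated by one of the finitely many deterministic ones. *)

From mathcomp Require Import all_boot all_order all_algebra.
From mathcomp Require Import reals.
Require Import Defs.

Set Implicit Arguments.
Unset Strict Implicit.
Unset Printing Implicit Defensive.

Import Order.TTheory GRing.Theory Num.Theory.
Local Open Scope ring_scope.

(** * Overwriting and summing out one coordinate of a full assignment *)

Section Coordinates.
Variables (V : finType) (X : V -> finType).
Implicit Types (B C D : {set V}) (x : assign X [set: V]).

Lemma coord_irr C v (h h' : v \in C) (x : assign X C) : coord h x = coord h' x.
Proof. by rewrite (bool_irrelevance h h'). Qed.

Lemma assignP C (x y : assign X C) :
  (forall v (h : v \in C), coord h x = coord h y) <-> x = y.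
Proof.
split=> [e|-> //]; apply/ffunP => -[v h]; exact: e.
Qed.

Lemma coord_restr C D (DC : D \subset C) (x : assign X C) v (vD : v \in D)
    (vC : v \in C) : coord vD (restr DC x) = coord vC x.
Proof. by rewrite /coord ffunE; apply: coord_irr. Qed.

Lemma restr_comp B C D (CB : C \subset B) (DC : D \subset C) (DB : D \subset B)
    (x : assign X B) : restr DC (restr CB x) = restr DB x.
Proof.
apply/assignP => v h.
by rewrite (coord_restr _ _ _ (subsetP DC _ h)) !(coord_restr _ _ _ (subsetP DB _ h)).
Qed.

Definition upd x v (a : X v) : assign X [set: V] :=
  [ffun i => @dfwith _ (fun i : {u | u \in [set: V]} => X (val i)) x
     (exist _ v (in_setT v)) a i].

Lemma coord_upd x v (a : X v) : coord (in_setT v) (upd x a) = a.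
Proof. by rewrite /coord ffunE dfwith_in. Qed.

Lemma coord_upd_neq x v (a : X v) u (h : u \in [set: V]) :
  u != v -> coord h (upd x a) = coord h x.
Proof. by move=> uv; rewrite /coord ffunE dfwith_out // eq_sym. Qed.

Lemma restr_upd x v (a : X v) C :
  v \notin C -> restr (subsetT C) (upd x a) = restr (subsetT C) x.
Proof.
move=> vC; apply/assignP => u h.
rewrite !(coord_restr _ _ h (in_setT u)) coord_upd_neq //.
by apply: contraNneq vC => <-.
Qed.

Lemma upd_upd x v (a b : X v) : upd (upd x a) b = upd x b.
Proof.
apply/assignP => u h; case: (eqVneq u v) h => [-> h|uv h].
  by rewrite !(coord_irr h (in_setT v)) !coord_upd.
by rewrite !coord_upd_neq.
Qed.

Lemma upd_coord x v : upd x (coord (in_setT v) x) = x.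
Proof.
apply/assignP => u h; case: (eqVneq u v) h => [-> h|uv h].
  by rewrite !(coord_irr h (in_setT v)) coord_upd.
by rewrite coord_upd_neq.
Qed.

(** Independence of coordinate [v], put as invariance under [upd] so that all sums keep ranging over
    full assignments. *)
Definition ignores (Y : Type) (h : assign X [set: V] -> Y) (v : V) :=
  forall x (a : X v), h (upd x a) = h x.

Section Sums.
Variable R : realType.
Implicit Types h F : assign X [set: V] -> R.

(** Exchanging [a] with the coordinate of [x] at [v] is an involution on the pairs [(x, a)]. The
    factor [#|X v|] is the price for never passing to assignments of the other coordinates. *)
Lemma sum_upd F v :
  #|X v|%:R * (\sum_x F x) = \sum_x \sum_(a : X v) F (upd x a).
Proof.
rewrite pair_big /=.
pose s (p : assign X [set: V] * X v) := (upd p.1 p.2, coord (in_setT v) p.1).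
have sK : involutive s.
  by case=> x a; rewrite /s /= upd_upd upd_coord coord_upd.
rewrite (reindex_inj (inv_inj sK)) /=.
transitivity (\sum_(p : assign X [set: V] * X v) F p.1); last first.
  by apply: eq_bigr => -[x a] _ /=; rewrite upd_upd upd_coord.
rewrite -(pair_big xpredT xpredT (fun x (_ : X v) => F x)) /= mulr_sumr.
by apply: eq_bigr => x _; rewrite sumr_const mulr_natl.
Qed.

Lemma sum_ignores h (q : assign X [set: V] -> R) v :
  ignores h v -> (forall x, \sum_(a : X v) q (upd x a) = 1) ->
  #|X v|%:R * (\sum_x h x * q x) = \sum_x h x.
Proof.
move=> ih q1; rewrite sum_upd; apply: eq_bigr => x _.
under eq_bigr do rewrite ih.
by rewrite -mulr_sumr q1 mulr1.
Qed.

End Sums.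

Lemma card_assignT : #|{: assign X [set: V]}| = (\prod_v #|X v|)%N.
Proof.
rewrite card_dep_ffun foldrE big_map big_enum /=.
rewrite (reindex (fun v => exist (fun v => v \in [set: V]) v (in_setT v))) //=.
exists val => [v|[v h]] //= _; exact: val_inj.
Qed.

End Coordinates.

(** * Ancestor counts and sources *)

Section DirectedGraph.
Variables (V : finType) (G : influence_diagram V).

(** The number of ancestors is a rank: those of [u] are among those of [v], and by acyclicity [v]
    itself is a new one. *)
Lemma edge_rank u v : edge G u v ->
  (#|[set w | connect (edge G) w u]| < #|[set w | connect (edge G) w v]|)%N.
Proof.
move=> uv; apply/proper_card/properP; split.
  apply/subsetP => w; rewrite !inE => /connect_trans; apply; exact: connect1.
by exists v; rewrite inE ?connect0 // (edge_acyclic uv).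
Qed.

Lemma has_source (S : {set V}) : S != set0 ->
  exists2 v, v \in S & forall u, u \in S -> ~~ edge G u v.
Proof.
case/set0Pn => v0 v0S.
have [v vS vmin] := arg_minnP (fun v => #|[set w | connect (edge G) w v]|) v0S.
exists v => // u /vmin; rewrite leqNgt; apply: contra; exact: edge_rank.
Qed.

End DirectedGraph.

(** * The product law of a family of kernels, and summing out descendants *)

Section Joint.
Variables (R : realType) (V : finType) (G : influence_diagram V).
Variables (X : V -> finType) (k : kernels R G X).
Implicit Types (S B C D : {set V}) (x : assign X [set: V]).

Definition weight S x : R := \prod_(v in S) factor k x v.

Lemma ignores_weight S v :
  v \notin S -> (forall u, edge G v u -> u \notin S) -> ignores (weight S) v.
Proof.
move=> vS chS x a; apply: eq_bigr => u uS; rewrite /factor.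
rewrite coord_upd_neq; last by apply: contraTneq uS => ->.
by rewrite restr_upd // inE; apply: contraTN uS => /chS.
Qed.

Hypothesis kd : forall v (y : assign X (pa G v)), is_dist (k y).

Lemma sum_factor x v : \sum_(a : X v) factor k (upd x a) v = 1.
Proof.
rewrite /factor; under eq_bigr => a _.
  rewrite coord_upd restr_upd; first over.
  by rewrite inE; apply/negP => /[dup] /edge_acyclic; rewrite connect0.
exact: (kd _).2.
Qed.

Definition child_closed S := forall u v, u \in S -> edge G u v -> v \in S.

(** Induction on [#|S|], removing a source [v] of [S]; the rest stays child-closed because no edge
    inside [S] enters [v]. Once the rest is summed out, only the factor of [v] depends on coordinate
    [v], as its children lie in [S], and that factor sums to 1. *)
Lemma sum_out S (g : assign X [set: V] -> R) :
  child_closed S -> (forall v, v \in S -> ignores g v) ->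
  (\prod_(v in S) #|X v|%:R) * (\sum_x g x * weight [set: V] x) =
  \sum_x g x * weight (~: S) x.
Proof.
have [n] := ubnP #|S|; elim: n S => // n IH S leSn chS gS.
have [->|/(has_source G)[v vS srcv]] := eqVneq S set0.
  by rewrite big_set0 mul1r setC0.
rewrite (big_setD1 v) //= -mulrA IH; first last.
- by move=> u; rewrite !inE => /andP[_]; exact: gS.
- move=> u w; rewrite !inE => /andP[_ uS] uw; rewrite (chS _ _ uS uw) andbT.
  by apply: contraTneq uw => ->; exact: srcv.
- by rewrite -ltnS (leq_trans _ leSn) // ltnS [X in (_ < X)%N](cardsD1 v) vS.
rewrite -(@sum_ignores _ _ _ (fun x => g x * weight (~: S) x)
                    (fun x => factor k x v) v).
- congr (_ * _); apply: eq_bigr => x _; rewrite -mulrA; congr (_ * _).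
  rewrite /weight (big_setD1 v) /=; last by rewrite !inE eqxx.
  rewrite mulrC; congr (_ * _); apply: eq_bigl => u; rewrite !inE.
  by case: eqVneq => // ->; rewrite vS.
- move=> x a; rewrite gS // ignores_weight //; first by rewrite inE vS.
  by move=> u /(chS _ _ vS); rewrite inE => ->.
- by move=> x; rewrite sum_factor.
Qed.

(** Summing out every vertex turns [c] times the total mass into the number of full assignments,
    which is [c] again. *)
Lemma sum_weight : (forall v, (0 < #|X v|)%N) -> \sum_x weight [set: V] x = 1.
Proof.
move=> X0; pose c : R := \prod_(v in [set: V]) #|X v|%:R.
have c0 : c != 0 by apply/prodf_neq0 => v _; rewrite pnatr_eq0 -lt0n.
apply: (mulfI c0); rewrite mulr1.
transitivity (c * \sum_x 1 * weight [set: V] x).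
  by congr (_ * _); apply: eq_bigr => x _; rewrite mul1r.
rewrite sum_out // setCT /weight.
under eq_bigr do rewrite big_set0 mulr1.
rewrite sumr_const card_assignT natr_prod.
by apply: eq_bigl => v; rewrite inE.
Qed.

Definition kprob C (y : assign X C) : R :=
  \sum_(x | restr (subsetT C) x == y) weight [set: V] x.

(** The proper descendants of [w] lie outside [C] and can be summed out on both sides. The two laws
    then differ by the factor of [w], whose value is fixed by [y] because [C] contains [w] and its
    parents. *)
Lemma kprob_nondesc C w (wC : w \in C) (paC : pa G w \subset C)
    (CwC : C :\ w \subset C) (y : assign X C) :
  (forall v, (0 < #|X v|)%N) ->
  {in C, forall u, connect (edge G) w u -> u = w} ->
  kprob y = kprob (restr CwC y) * k (restr paC y) (coord wC y).
Proof.
move=> X0 Cnd; pose D := [set u | connect (edge G) w u].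
have wD : w \in D by rewrite inE connect0.
have chD : child_closed D.
  by move=> u v; rewrite !inE => /connect_trans wu uv; apply/wu/connect1.
have chDw : child_closed (D :\ w).
  move=> u v; rewrite !inE => /andP[_ wu] uv.
  rewrite (connect_trans wu (connect1 uv)) andbT.
  by apply: contraTneq wu => vw; apply: edge_acyclic; rewrite -vw.
pose g B (z : assign X B) x : R := (restr (subsetT B) x == z)%:R.
have kprobE B (z : assign X B) : kprob z = \sum_x g B z x * weight [set: V] x.
  rewrite /kprob big_mkcond; apply: eq_bigr => x _.
  by rewrite /g; case: eqP; rewrite ?mul1r ?mul0r.
have ig B (z : assign X B) v : v \notin B -> ignores (g B z) v.
  by move=> vB x a; rewrite /g restr_upd.
pose c : R := \prod_(v in D) #|X v|%:R.
have c0 : c != 0 by apply/prodf_neq0 => v _; rewrite pnatr_eq0 -lt0n.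
apply: (mulfI c0).
(* On the right no vertex of [D] is observed, so all of [D] is summed out. *)
rewrite mulrA {2}/c (kprobE (C :\ w)) sum_out //; last first.
  move=> v; rewrite inE => wv; apply: ig; rewrite !inE.
  by apply/negP => /andP[/eqP vw vC]; apply/vw/Cnd.
(* On the left [w] is observed, so only [D :\ w] is summed out and a factor [#|X w|] remains. *)
rewrite /c (big_setD1 w) //= -mulrA kprobE sum_out //; last first.
  move=> v; rewrite !inE => /andP[vw wv]; apply: ig.
  by apply: contraNN vw => vC; apply/eqP/Cnd.
(* The summand on the right is constant in coordinate [w]; inserting this indicator pins [w] to its
   value in [y] and produces the matching factor [#|X w|]. *)
pose one x : R := (coord (in_setT w) x == coord wC y)%:R.
rewrite -(@sum_ignores _ _ _
  (fun x => g (C :\ w) (restr CwC y) x * weight (~: D) x) one w); first last.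
- move=> x; rewrite /one; under eq_bigr do rewrite coord_upd.
  by rewrite (bigD1 (coord wC y)) //= eqxx big1 ?addr0 // => a /negPf ->.
- move=> x a; rewrite ig ?inE ?eqxx // ignores_weight ?inE ?connect0 //.
  by move=> u wu; rewrite !inE (connect1 wu).
rewrite -mulrA; congr (_ * _); rewrite mulr_suml; apply: eq_bigr => x _.
have -> : weight (~: (D :\ w)) x = factor k x w * weight (~: D) x.
  rewrite /weight (big_setD1 w) /=; last by rewrite !inE eqxx.
  congr (_ * _); apply: eq_bigl => u; rewrite !inE.
  by case: eqVneq => // ->; rewrite connect0.
have gE : g C y x = g (C :\ w) (restr CwC y) x * one x.
  rewrite /g /one -natrM mulnb; congr (_%:R); congr nat_of_bool.
  apply/eqP/andP => [<-|[/eqP e1 /eqP e2]].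
    by rewrite (restr_comp _ _ (subsetT _)) coord_restr !eqxx.
  apply/assignP => v vC; rewrite (coord_restr _ _ _ (in_setT v)).
  have [vw|vw] := eqVneq v w.
    by move: vC; rewrite vw => vC; rewrite e2; exact: coord_irr.
  have vCw : v \in C :\ w by rewrite !inE vw.
  by rewrite -(coord_restr CwC _ vCw) -e1; rewrite (coord_restr _ _ _ (in_setT v)).
have gf : g C y x * factor k x w = g C y x * k (restr paC y) (coord wC y).
  rewrite /g; case: eqP => [<-|_]; last by rewrite !mul0r.
  by rewrite (restr_comp _ _ (subsetT _)) coord_restr.
by rewrite mulrA gf gE; rewrite -!mulrA; congr (_ * _); rewrite mulrA mulrC.
Qed.

Lemma kprob_ge0 C (y : assign X C) : 0 <= kprob y.
Proof. by apply: sumr_ge0 => x _; apply: prodr_ge0 => v _; apply: (kd _).1. Qed.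

Lemma sum_kprob C (f : assign X C -> R) :
  \sum_y kprob y * f y =
  \sum_x weight [set: V] x * f (restr (subsetT C) x).
Proof.
rewrite [RHS](partition_big (restr (subsetT C)) xpredT) //=.
apply: eq_bigr => y _; rewrite /kprob mulr_suml.
by apply: eq_bigr => x /eqP ->.
Qed.

Lemma kprob_dist C : (forall v, (0 < #|X v|)%N) -> is_dist (@kprob C).
Proof.
move=> X0; split; first exact: kprob_ge0.
under eq_bigr do rewrite -[kprob _]mulr1.
rewrite (sum_kprob (fun=> 1)); under eq_bigr do rewrite mulr1.
exact: sum_weight.
Qed.

End Joint.

(** * Composition of marginals *)

Section Marginals.
Variables (R : realType) (V : finType) (X : V -> finType).
Implicit Types (B C D : {set V}).

Lemma eq_marg C D (DC : D \subset C) (f g : assign X C -> R) :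
  f =1 g -> marg DC f =1 marg DC g.
Proof. by move=> fg y; apply: eq_bigr => x _; exact: fg. Qed.

Lemma marg_marg B C D (CB : C \subset B) (DC : D \subset C) (DB : D \subset B)
  (f : assign X B -> R) : marg DC (marg CB f) =1 marg DB f.
Proof.
move=> z; rewrite /marg.
rewrite (exchange_big_dep (fun x => restr DB x == z)) /=.
  apply: eq_bigr => x /eqP xz.
  rewrite (big_pred1 (restr CB x)) // => y /=; rewrite [RHS]eq_sym.
  have [<-|] := eqVneq (restr CB x) y; rewrite ?andbF //.
  by rewrite (restr_comp _ _ DB) xz eqxx.
by move=> y x /eqP <- /eqP <-; rewrite (restr_comp _ _ DB).
Qed.

(** [kprob] is convertible to the marginal of [weight [set: V]], so this is [marg_marg] started from
    the full vertex set. *)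
Lemma marg_kprob (G : influence_diagram V) (k : kernels R G X) C D
  (DC : D \subset C) : marg DC (@kprob _ _ _ _ k C) =1 @kprob _ _ _ _ k D.
Proof. exact: marg_marg. Qed.

Lemma marg_set0 C (DC : set0 \subset C) (f : assign X C -> R) y :
  marg DC f y = \sum_x f x.
Proof.
by apply: eq_bigl => x; apply/eqP/assignP => v vD; have := vD; rewrite inE.
Qed.

End Marginals.

(** * Orientation of the rooted tree and position of the root cliques *)

Section Trees.
Variables (V : finType) (G : influence_diagram V) (T : rjt G).

Lemma tarc_adj : subrel (tarc T) (adj T).
Proof. by move=> C D CD; rewrite /adj /= CD. Qed.

Lemma adj_sym : symmetric (adj T).
Proof. by case: (rjt_rooted T) => -[]. Qed.

Lemma adj_nodes C D : adj T C D -> [/\ C \in nodes T, D \in nodes T & C != D].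
Proof. case: (rjt_rooted T) => -[_ adjN _ _] _ _ _; exact: adjN. Qed.

Lemma simple_path_uniq C D p q : C \in nodes T -> D \in nodes T ->
  simple_path (adj T) C p D -> simple_path (adj T) C q D -> p = q.
Proof.
case: (rjt_rooted T) => -[_ _ _ up] _ _ _ CT DT.
by have [r [_ ru]] := up _ _ CT DT; move=> /ru <- /ru <-.
Qed.

(** A directed path back from [D] to [C] shortens to a simple path, which in a tree must be the
    single edge between them; that edge would then be oriented both ways. *)
Lemma tarc_acyclic C D : tarc T C D -> ~~ connect (tarc T) D C.
Proof.
move=> CD; apply/negP => /connectP[p Dp Ce].
have [CT DT nCD] := adj_nodes (tarc_adj CD).
move: Ce; case: (shortenP Dp) => q Dq uq _ Ce.
have sq : simple_path (adj T) D q C by split=> //; exact: sub_path tarc_adj _ _ Dq.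
have s1 : simple_path (adj T) D [:: C] C.
  by split; rewrite //= ?inE ?andbT 1?eq_sym // adj_sym (tarc_adj CD).
move: Dq; rewrite (simple_path_uniq DT CT sq s1) /= andbT => DC.
by case: (rjt_rooted T) => _ _ /(_ _ _ CD); rewrite DC.
Qed.

Lemma connect_tarc_anti C D :
  connect (tarc T) C D -> connect (tarc T) D C -> C = D.
Proof.
case/connectP=> -[|E p] /=; first by move=> _ ->.
case/andP=> CE Ep -> DC; have := tarc_acyclic CE.
by rewrite (connect_trans _ DC) //; apply/connectP; exists p.
Qed.

(** A simple directed path from the root to [C] avoids [D], since otherwise [D] would reach [C]
    against acyclicity; hence [D] can be appended to it. *)
Lemma root_simple_path C D : tarc T C D ->
  exists2 p, simple_path (adj T) (root T) (rcons p D) D & last (root T) p = C.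
Proof.
move=> CD; have [CT DT _] := adj_nodes (tarc_adj CD).
case: (rjt_rooted T) => _ _ _ /(_ _ CT)/connectP[p rp Ce].
move: Ce; case: (shortenP rp) => q rq uq _ Ce; exists q => //; split.
- rewrite rcons_path -Ce (tarc_adj CD) andbT; exact: sub_path tarc_adj _ _ rq.
- rewrite -rcons_cons rcons_uniq uq andbT; apply: contra (tarc_acyclic CD).
  rewrite Ce; move: rq => /[swap]; case/splitPl=> q1 q2 <-.
  by rewrite cat_path last_cat => /andP[_ q2p]; apply/connectP; exists q2.
- by rewrite last_rcons.
Qed.

Lemma tarc_parent_uniq C C' D : tarc T C D -> tarc T C' D -> C = C'.
Proof.
move=> CD C'D; have [p sp <-] := root_simple_path CD.
have [q sq <-] := root_simple_path C'D.
have [_ DT _] := adj_nodes (tarc_adj CD).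
have rT : root T \in nodes T by case: (rjt_rooted T).
by have /rcons_inj[->] := simple_path_uniq rT DT sp sq.
Qed.

Lemma tree_ind (Q : {set V} -> Prop) : Q (root T) ->
  (forall C D, tarc T C D -> Q C -> Q D) -> {in nodes T, forall C, Q C}.
Proof.
move=> Qr Qs C; case: (rjt_rooted T) => _ _ _ rc /rc/connectP[p rp ->].
elim/last_ind: p rp => //= p D IH; rewrite rcons_path last_rcons.
by case/andP=> /IH Qp /Qs; exact.
Qed.

(** The default [set0] is excluded because [v] belongs to [root_clique T v]. *)
Lemma root_cliqueP v : is_root_clique T v (root_clique T v).
Proof.
have := mem_root_clique T v; rewrite /root_clique.
by case: pickP => //= _; rewrite inE.
Qed.

Lemma root_clique_nodes v : root_clique T v \in nodes T.
Proof. by case/and3P: (root_cliqueP v). Qed.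

Lemma root_clique_connect v C : C \in nodes T -> v \in C ->
  connect [rel A B | [&& tarc T A B, v \in A & v \in B]] (root_clique T v) C.
Proof.
case/and3P: (root_cliqueP v) => _ _ /forallP/(_ C)/implyP vP CT vC.
by apply: vP; rewrite CT.
Qed.

Lemma root_clique_above v C : C \in nodes T -> v \in C ->
  connect (tarc T) (root_clique T v) C.
Proof.
move=> CT vC; apply: connect_sub (root_clique_connect CT vC) => A B.
by case/and3P=> AB _ _; exact: connect1.
Qed.

(** A parent of [w] lies in the root clique of [w], so its own root clique is above; this is
    iterated along a path of [G]. *)
Lemma connect_root_clique u v : connect (edge G) u v ->
  connect (tarc T) (root_clique T u) (root_clique T v).
Proof.
case/connectP=> p; elim: p u => [|w p IH] u /=; first by move=> _ ->.
case/andP=> uw wp /(IH _ wp); apply: connect_trans.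
apply: root_clique_above; first exact: root_clique_nodes.
by apply: (subsetP (pa_root_clique T w)); rewrite inE.
Qed.

Hypothesis hT : singleton_offspring T.

Lemma root_clique_inj : injective (root_clique T).
Proof.
move=> u v uv; apply/set1P; rewrite -(hT.1 v) inE uv; exact: eqxx.
Qed.

Lemma nodesP C : C \in nodes T -> exists v, C = root_clique T v.
Proof. by rewrite hT.2 => /imsetP[v _ ->]; exists v. Qed.

(** Membership of [u] puts its root clique above that of [v], descent puts it below; so the cliques
    coincide, and each has one offspring. *)
Lemma root_clique_nondesc v :
  {in root_clique T v, forall u, connect (edge G) v u -> u = v}.
Proof.
move=> u uv vu; apply: root_clique_inj; apply: connect_tarc_anti.
  exact: root_clique_above (root_clique_nodes v) uv.
exact: connect_root_clique.
Qed.

Lemma check_clique_root v : root_clique T v = root T -> check_clique T v = set0.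
Proof.
move=> vr; apply/setP => u; rewrite !inE; apply/negP => /andP[/eqP uv uC].
apply: uv; apply: root_clique_inj; apply: connect_tarc_anti.
  exact: root_clique_above (root_clique_nodes v) uC.
rewrite vr; case: (rjt_rooted T) => _ _ _; apply; exact: root_clique_nodes.
Qed.

(** The cliques containing [u] include a directed path from the root clique of [u] to that of [v].
    It is nonempty as [u] differs from [v], and its last arc comes from the unique parent [D]. *)
Lemma check_clique_parent v D :
  tarc T D (root_clique T v) -> check_clique T v \subset D.
Proof.
move=> Dv; apply/subsetP => u; rewrite inE => /andP[/set1P uv uC].
have /connectP[p] := root_clique_connect (root_clique_nodes v) uC.
case/lastP: p => [_ /root_clique_inj/esym //|p E].
rewrite rcons_path last_rcons => /andP[_ /and3P[lE ul _]] Ev.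
by rewrite (tarc_parent_uniq Dv (C' := last (root_clique T u) p)) // Ev.
Qed.

End Trees.

(** * Moments of a policy and feasible points of the nonlinear program *)

Section MixedKernel.
Variables (R : realType) (V : finType) (G : influence_diagram V).
Variables (X : V -> finType) (P : parametrization R G X).
Implicit Type delta : kernels R G X.

(** Merges policy and model into one family of kernels, so that the results on product laws treat
    all vertices alike. *)
Definition mix delta : kernels R G X :=
  fun v => if v \in decv G then delta v else kern P (v := v).

Lemma mix_dist delta : policies delta ->
  forall v (y : assign X (pa G v)), is_dist (mix delta y).
Proof.
move=> pd v y; rewrite /mix; case: ifP => vd; first exact: pd.
by apply: (kern_dist P); rewrite inE vd.
Qed.

Lemma joint_weight delta x : joint P delta x = weight (mix delta) [set: V] x.
Proof.
rewrite /weight (eq_bigl xpredT) => [|v]; last by rewrite inE.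
rewrite (bigID (mem (decv G))) /= mulrC; congr (_ * _).
  apply: eq_big => v; first by rewrite inE.
  by rewrite inE /factor /mix => /negPf ->.
by apply: eq_bigr => v vd; rewrite /factor /mix vd.
Qed.

Lemma prob_kprob delta C (y : assign X C) : prob P delta y = kprob (mix delta) y.
Proof. by apply: eq_bigr => x _; exact: joint_weight. Qed.

Variable T : rjt G.

Lemma factorizes_mix delta (mu : moments R X T) :
  (forall v, factorizes (mix delta) mu v) <->
  {in statev G, forall v, factorizes (@kern _ _ _ _ P) mu v} /\
  {in decv G, forall v, factorizes delta mu v}.
Proof.
rewrite /factorizes /mix; split=> [fm|[fs fd] v].
  split=> v vG x; rewrite fm; first by move: vG; rewrite inE => /negPf ->.
  by rewrite vG.
by case: ifP => vG x; [exact: fd | apply: fs; rewrite inE vG].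
Qed.

Definition moments_of (k : kernels R G X) : moments R X T :=
  Moments (fun v => @kprob _ _ _ _ k (root_clique T v))
          (fun v => @kprob _ _ _ _ k (check_clique T v)).

(** Each reward reads a single coordinate, so by linearity its expectation needs only the law of one
    root clique. *)
Lemma nlp_objective_moments delta (mu : moments R X T) :
  (forall v, @mu_clique _ _ _ _ _ mu v =1 @kprob _ _ _ _ (mix delta) _) ->
  nlp_objective P mu = meu_objective P delta.
Proof.
move=> muE; rewrite /meu_objective /expectation.
under [RHS]eq_bigr do rewrite mulr_sumr.
rewrite exchange_big /=; apply: eq_bigr => v _.
transitivity (\sum_(y : assign X (root_clique T v))
    kprob (mix delta) y * reward P (coord (mem_root_clique T v) y)).
  rewrite [RHS](partition_big (coord (mem_root_clique T v)) xpredT) //=.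
  apply: eq_bigr => a _; rewrite mulr_sumr.
  by apply: eq_bigr => y /eqP ->; rewrite muE mulrC.
rewrite (sum_kprob _ (fun y => reward P (coord (mem_root_clique T v) y))).
apply: eq_bigr => x _; rewrite joint_weight.
by rewrite (coord_restr _ _ _ (in_setT v)).
Qed.

Hypothesis hT : singleton_offspring T.

Lemma kprob_root_clique delta v (x : assign X (root_clique T v)) :
  policies delta ->
  kprob (mix delta) x =
    kprob (mix delta) (restr (check_clique_sub T v) x) *
    mix delta (restr (pa_root_clique T v) x) (coord (mem_root_clique T v) x).
Proof.
move=> pd; apply: kprob_nondesc; first exact: mix_dist.
  exact: (space_gt0 P).
exact: root_clique_nondesc.
Qed.

Lemma moments_of_feasible delta :
  policies delta -> NLP_feasible P (moments_of (mix delta), delta).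
Proof.
move=> pd; have [fs fd] : _ /\ _ := (factorizes_mix delta (moments_of _)).1
  (fun v x => kprob_root_clique x pd).
split; [split; [|exact: fs] | exact: pd | exact: fd].
split=> [v|u v _ y|v y] /=.
- by apply: kprob_dist; [exact: mix_dist | exact: (space_gt0 P)].
- by rewrite !marg_kprob.
- by rewrite marg_kprob.
Qed.

Lemma feasible_moments delta (mu : moments R X T) :
  NLP_feasible P (mu, delta) ->
  forall v, @mu_clique _ _ _ _ _ mu v =1 @kprob _ _ _ _ (mix delta) _.
Proof.
case=> /= -[[mu1 muadj muchk] fs] pd fd v.
have fm := (factorizes_mix delta mu).2 (conj fs fd).
have kp C := @kprob_dist _ _ _ _ _ (mix_dist pd) C (space_gt0 P).
(* The factorization carries equality from the check clique to the whole clique, so only check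
   cliques remain to be treated. *)
have step w : @mu_check _ _ _ _ _ mu w =1 @kprob _ _ _ _ (mix delta) _ ->
    @mu_clique _ _ _ _ _ mu w =1 @kprob _ _ _ _ (mix delta) _.
  by move=> muw x; rewrite fm muw -kprob_root_clique.
pose Q C := forall w, root_clique T w = C ->
  @mu_clique _ _ _ _ _ mu w =1 @kprob _ _ _ _ (mix delta) _.
suff QT : {in nodes T, forall C, Q C} by exact: QT (root_clique_nodes T v) v erefl.
apply: tree_ind => [w wr|C D CD QC w wD]; apply: step => y.
  rewrite muchk -(marg_kprob _ (check_clique_sub T w)).
  (* At the root the check clique is empty, and both sides are total masses equal to 1. The
     inclusion and [y] are generalized because their types mention the clique being rewritten. *)
  move: (check_clique_sub T w) y; rewrite (check_clique_root hT wr) => h y.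
  by rewrite !marg_set0 (mu1 w).2 (kp _).2.
have [CT _ _] := adj_nodes (tarc_adj CD).
have [u Cu] := nodesP hT CT; rewrite {C}Cu -{D}wD in CD QC CT *.
(* The check clique lies in the separator between [w] and its parent, so local consistency moves its
   marginal to the parent, where equality is already known. *)
have wI : check_clique T w \subset root_clique T u :&: root_clique T w.
  by rewrite subsetI check_clique_parent // check_clique_sub.
rewrite muchk -(marg_marg (subsetIr (root_clique T u) _) wI).
rewrite -(eq_marg _ (muadj _ _ (tarc_adj CD))).
rewrite (eq_marg _ (eq_marg _ (QC u erefl))).
by rewrite (eq_marg _ (marg_kprob _ _)) marg_kprob.
Qed.

End MixedKernel.

(** * Deterministic policies and existence of the maximum *)

Section Deterministic.
Variables (R : realType) (V : finType) (G : influence_diagram V).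
Variables (X : V -> finType) (P : parametrization R G X).
Implicit Type delta : kernels R G X.

(** Vertices paired with parent configurations form one finite type, so situations can be enumerated
    and a deterministic policy is a function on them. *)
Definition info := {v : V & assign X (pa G v)}.
Local Notation situation y := (Tagged (fun v => assign X (pa G v)) y).

(* Comparing tagged values avoids a transport along [tag i = v]. *)
Definition dirac (i : info) (a : X (tag i)) v (b : X v) : R :=
  (Tagged X b == Tagged X a)%:R.

Definition setk delta (i : info) (a : X (tag i)) : kernels R G X :=
  fun v y b => if situation y == i then dirac a b
               else delta v y b.

Lemma dirac_dist (i : info) (a : X (tag i)) : is_dist (@dirac i a (tag i)).
Proof.
split=> [b|]; first exact: ler0n.
rewrite (bigD1 a) //= /dirac eqxx big1 ?addr0 // => b ba.
by rewrite eq_Tagged /= (negPf ba).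
Qed.

Lemma policies_setk delta (i : info) (a : X (tag i)) :
  policies delta -> policies (setk delta a).
Proof.
move=> pd v vd y; rewrite /setk; case: eqP => [iy|_]; last exact: pd.
by case: i / iy a => a; exact: (dirac_dist a).
Qed.

(** For each [x] the law at [i] enters the product over decisions at most once, hence the joint law
    is affine in it. *)
Lemma joint_setk delta (i : info) x : tag i \in decv G -> policies delta ->
  joint P delta x = \sum_a delta _ (tagged i) a * joint P (setk delta a) x.
Proof.
case: i => v0 y0 /= v0d pd; rewrite /joint.
under [RHS]eq_bigr do rewrite mulrCA; rewrite -mulr_sumr; congr (_ * _).
(* If [x] does not meet the situation, no factor changes and the weights sum to 1; otherwise only
   the action taken in [x] contributes. *)
have [xy|xy] := eqVneq (restr (subsetT (pa G v0)) x) y0; last first.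
  transitivity (\sum_a delta _ y0 a * \prod_(v in decv G) factor delta x v).
    by rewrite -mulr_suml (pd _ v0d y0).2 mul1r.
  apply: eq_bigr => a _; congr (_ * _); apply: eq_bigr => v vd.
  rewrite /factor /setk; case: eqP => // e.
  have /= vv0 := congr1 tag e; subst v0; case/negP: xy.
  by move/eqP: e; rewrite eq_Tagged.
have hit a : factor (@setk delta (situation y0) a) x v0 =
             (coord (in_setT v0) x == a)%:R.
  by rewrite /factor /setk xy eqxx /dirac eq_Tagged.
rewrite (bigD1 v0) //=; set p := \prod_(_ in _ | _) _.
rewrite (bigD1 (coord (in_setT v0) x)) //= [X in _ + X]big1 ?addr0 => [|a ax].
  rewrite [X in _ = _ * X](bigD1 v0) //= hit eqxx mul1r {1}/factor xy.
  congr (_ * _); apply: eq_bigr => v /andP[_ vv0]; rewrite /factor /setk.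
  by case: eqP => // /(congr1 tag) /= e; rewrite e eqxx in vv0.
by rewrite (bigD1 v0) //= hit eq_sym (negPf ax) mul0r mulr0.
Qed.

(** The value of [delta] is an average of the values over the actions [a], so a best action does at
    least as well. *)
Lemma meu_setk delta (i : info) : tag i \in decv G -> policies delta ->
  exists a, meu_objective P delta <= meu_objective P (@setk delta i a).
Proof.
move=> id pd; have [d0 d1] := pd _ id (tagged i).
pose F a := meu_objective P (@setk delta i a).
have [a0 _] : exists a : X (tag i), a \in X (tag i) by apply/card_gt0P/(space_gt0 P).
pose m := [arg max_(a > a0) F a]%O; exists m.
have mF a : F a <= F m by rewrite /m; case: arg_maxP => // b _; apply.
have -> : meu_objective P delta = \sum_a delta _ (tagged i) a * F a.
  rewrite /F /meu_objective /expectation.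
  under [RHS]eq_bigr do rewrite mulr_sumr.
  rewrite exchange_big /=; apply: eq_bigr => x _.
  rewrite (joint_setk x id pd) mulr_suml.
  by apply: eq_bigr => a _; rewrite mulrA.
rewrite -[leRHS]mul1r -d1 mulr_suml.
by apply: ler_sum => a _; apply: ler_wpM2l.
Qed.

Lemma meu_deterministic delta (s : seq info) : policies delta ->
  exists delta' : kernels R G X, [/\ policies delta',
    meu_objective P delta <= meu_objective P delta'
  & forall i, i \in s -> tag i \in decv G ->
      exists a, delta' _ (tagged i) =1 @dirac i a (tag i)].
Proof.
move=> pd; elim: s => [|i s [d [pd' le_d ds]]]; first by exists delta.
case: (boolP (tag i \in decv G)) => id; last first.
  exists d; split=> // j; rewrite inE => /predU1P[-> jd|]; last exact: ds.
  by rewrite jd in id.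
have [a le_a] := meu_setk id pd'; exists (setk d a); split.
- exact: policies_setk.
- exact: le_trans le_a.
- move=> j; rewrite inE => js jd; rewrite /setk taggedK.
  (* The new replacement either fixes situation [j] itself or leaves its point mass untouched. *)
  case: eqP js => [->|_ /= js]; first by exists a.
  exact: ds.
Qed.

Definition rule := {dffun forall i : info, X (tag i)}.

Definition detk (f : rule) : kernels R G X :=
  fun v y => @dirac _ (f (situation y)) v.

Lemma policies_detk f : policies (detk f).
Proof. 
by move=> v _ y; exact: (dirac_dist (f (situation y))).
Qed.

Lemma meu_max : exists z, max_value (@policies R V G X) (meu_objective P) z.
Proof.
have x0 v : X v by have /card_gt0P/sigW[] := space_gt0 P v.
pose F (f : rule) := meu_objective P (detk f).
pose f0 : rule := [ffun i => x0 (tag i)].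
pose m := [arg max_(f > f0) F f]%O.
have mF f : F f <= F m by rewrite /m; case: arg_maxP => // g _; apply.
exists (F m); split; first by exists (detk m); first exact: policies_detk.
move=> delta pd; have [d [_ le_d dd]] := meu_deterministic (enum {: info}) pd.
apply: le_trans le_d _.
(* The rule is read back from [d] as the action of probability 1; the default is not reached at
   decision vertices. *)
pose f : rule := [ffun i => odflt (x0 (tag i)) [pick a | d _ (tagged i) a == 1]].
suff -> : meu_objective P d = F f by [].
apply: eq_bigr => x _; congr (_ * _); rewrite /joint; congr (_ * _).
apply: eq_bigr => v vd; rewrite /factor /detk.
have [] := dd (situation (restr (subsetT (pa G v)) x)) (mem_enum _ _) vd.
move=> a /= da; rewrite da ffunE /=; case: pickP => [b|/(_ a)].
  rewrite [d _ _ b]da /dirac eq_Tagged /=.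
  by have [->|_] := eqVneq b a; rewrite // eq_sym oner_eq0.
by rewrite da /dirac !eqxx.
Qed.

End Deterministic.

(** * Equality of the three values *)

Theorem theorem2 (R : realType) (V : finType) (G : influence_diagram V)
    (X : V -> finType) (P : parametrization R G X) (T : rjt G)
    (hT : singleton_offspring T) :
  (exists z : R,
    [/\ max_value (@policies R V G X) (meu_objective P) z,
        max_value (@NLP_feasible R V G X P T) (fun md => nlp_objective P md.1) z
      & max_value (@SG R V G X P T) (nlp_objective P (T := T)) z]) /\
  (forall (mu : moments R X T) (delta : kernels R G X),
    NLP_feasible P (mu, delta) ->
    policies delta /\
    forall (v : V) (x : assign X (root_clique T v)),
      mu_clique mu x = prob P delta x).
Proof.
split=> [|mu delta h]; last first.
  by split=> [|v x]; [case: h | rewrite prob_kprob (feasible_moments hT h)].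
have [z [[d pd dz] zmax]] := meu_max P; exists z.
(* A feasible pair carries the moments of its own policy, so [zmax] bounds its value; the moments of
   the optimal [d] attain the bound. *)
have objE (mu : moments R X T) delta : NLP_feasible P (mu, delta) ->
    nlp_objective P mu = meu_objective P delta.
  by move=> /(feasible_moments hT)/nlp_objective_moments.
have df := moments_of_feasible P hT pd.
split; first by split; first exists d.
  split=> [|[mu delta] h /=];
    first by exists (moments_of T (mix P d), d); rewrite //= (objE _ _ df).
  by rewrite (objE _ _ h); apply: zmax; case: h.
split=> [|mu [muP [delta [pdelta fd]]]].
  exists (moments_of T (mix P d)); last rewrite (objE _ _ df) //.
  by case: df => *; split=> //; exists d.
have h : NLP_feasible P (mu, delta) by [].
by rewrite (objE _ _ h); exact: zmax.
Qed.
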